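(* The following are equivalent for any graph $G$: (1) $G$ satisfies the maximality principle $\Diamond\Box\varphi(\bar a)\to\varphi(\bar a)$ for every assertion $\varphi$ in the modal language of graph theory $\Diamond\mathcal{L}_\sim$, allowing parameters $\bar a=(a_0,\ldots,a_n)$ from $G$. (2) $G$ satisfies the maximality principle $\Diamond\Box\varphi(\bar a)\to\varphi(\bar a)$ for every assertion $\varphi$ in the language of graph theory $\mathcal{L}_\sim$, allowing parameters $\bar a=(a_0,\ldots,a_n)$ from $G$. (3) $G$ satisfies the maximality principle $\Diamond\Box\varphi(\bar a)\to\varphi(\bar a)$ for every existential assertion $\varphi=\exists x\,\varphi_0(x,\bar a)$ in the language of graph theory, with $\varphi_0$ quantifier free, allowing parameters $\bar a=(a_0,\ldots,a_n)$ from $G$. (4) $G$ fulfills the finite pattern property.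
   Context: A graph is a set of vertices (of any cardinality) together with an irreflexive symmetric binary edge relation $\sim$. $\mathcal{L}_\sim$ is the first-order language (with equality) whose only non-logical symbol is $\sim$. $\Diamond\mathcal{L}_\sim$ is the closure of the set of $\mathcal{L}_\sim$-formulas under the modal operators $\Diamond,\Box$ and Boolean connectives, but not quantifiers (so no modal operator occurs in the scope of a quantifier). Formulas are evaluated at graphs, within the class of all graphs under the substructure relation: $G\models\Diamond\varphi[\bar a]$ iff there is a graph $H$ containing $G$ as a substructure (i.e. $G$ is an induced subgraph of $H$) with $H\models\varphi[\bar a]$; $G\models\Box\varphi[\bar a]$ iff $H\models\varphi[\bar a]$ for every graph $H$ containing $G$ as a substructure; Boolean connectives and first-order formulas are interpreted as usual. The finite pattern property for $G$ asserts that for any two disjoint finite sets of vertices $A$ and $B$ of $G$, there is a vertex $v$ of $G$ adjacent to every vertex in $A$ and to no vertex in $B$. *)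

(* Defs.v *)
From mathcomp Require Import all_boot.
From mathcomp Require Import boolp classical_sets functions cardinality.

Set Implicit Arguments.
Unset Strict Implicit.
Unset Printing Implicit Defensive.

Local Open Scope classical_set_scope.

(** The vertex type is arbitrary; in particular it may be empty. *)
Record graph : Type := Graph {
  vertex :> Type;
  adj : vertex -> vertex -> Prop;
  adj_irrefl : forall x, ~ adj x x;
  adj_sym : forall x y, adj x y -> adj y x
}.

(** "[H] contains [G] as a substructure", the inclusion map being [f]. As there
    is no global inclusion between types, a parameter [a] of [G] becomes [f a]
    when it is evaluated in [H]. *)
Definition substructure (G H : graph) (f : G -> H) : Prop :=
  injective f /\ forall x y : G, adj (f x) (f y) <-> adj x y.

(** First-order formulas with free variables among [0, ..., n - 1]. Scoping is
    part of the type so that assignments exist over the empty graph when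
    [n = 0]. A quantifier binds variable [ord0] of its body; variable [i] of the
    context is [lift ord0 i] under the binder. *)
Inductive form (n : nat) : Type :=
| FEq of 'I_n & 'I_n
| FAdj of 'I_n & 'I_n
| FNot of form n
| FAnd of form n & form n
| FOr of form n & form n
| FImp of form n & form n
| FAll of form n.+1
| FEx of form n.+1.

Fixpoint quantifier_free n (p : form n) : bool :=
  match p with
  | FEq _ _ | FAdj _ _ => true
  | FNot p => quantifier_free p
  | FAnd p q | FOr p q | FImp p q => quantifier_free p && quantifier_free q
  | FAll _ | FEx _ => false
  end.

Definition push (V : Type) n (x : V) (a : 'I_n -> V) : 'I_n.+1 -> V :=
  fun i => if unlift ord0 i is Some j then a j else x.

Fixpoint fsat (G : graph) n (p : form n) : ('I_n -> G) -> Prop :=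
  match p with
  | FEq i j => fun a => a i = a j
  | FAdj i j => fun a => adj (a i) (a j)
  | FNot p => fun a => ~ fsat p a
  | FAnd p q => fun a => fsat p a /\ fsat q a
  | FOr p q => fun a => fsat p a \/ fsat q a
  | FImp p q => fun a => fsat p a -> fsat q a
  | FAll p => fun a => forall x, fsat p (push x a)
  | FEx p => fun a => exists x, fsat p (push x a)
  end.

(** There is no quantifier here: modal operators never occur in the scope of
    one. *)
Inductive mform (n : nat) : Type :=
| MForm of form n
| MNot of mform n
| MAnd of mform n & mform n
| MOr of mform n & mform n
| MImp of mform n & mform n
| MDia of mform n
| MBox of mform n.

Fixpoint msat n (p : mform n) (G : graph) (a : 'I_n -> G) : Prop :=
  match p with
  | MForm p => fsat p a
  | MNot p => ~ msat p a
  | MAnd p q => msat p a /\ msat q a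
  | MOr p q => msat p a \/ msat q a
  | MImp p q => msat p a -> msat q a
  | MDia p => exists (H : graph) (f : G -> H), substructure f /\ msat p (f \o a)
  | MBox p => forall (H : graph) (f : G -> H), substructure f -> msat p (f \o a)
  end.

Definition maximality n (p : mform n) : mform n := MImp (MDia (MBox p)) p.

Definition finite_pattern_property (G : graph) : Prop :=
  forall A B : set G, finite_set A -> finite_set B -> A `&` B = set0 ->
  exists v : G, (forall x, A x -> adj v x) /\ (forall x, B x -> ~ adj v x).

(* Main.v *)
(** The truth value at [(G, a)] of a modal assertion without quantified
    modalities depends only on the first-order theory of [(G, a)]: if [(G, a)]
    and [(H, b)] are elementarily equivalent and [G] is a substructure of [G'],
    then every finite piece of [H] embeds over [b] in [G'], so that [H] embeds
    over [b] in an ultrapower of [G'], which has the same theory as [G'].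

    If [G] has the finite pattern property and is a substructure of [H], then
    likewise [H] embeds, over any given tuple of parameters of [G], in an
    ultrapower of [G]; hence an assertion possibly necessary at [G], witnessed by
    [H], is true at that ultrapower and therefore at [G]. Conversely, adding one
    vertex to [G] makes any instance of the finite pattern property necessary,
    and such an instance is an existential assertion. *)
From Stdlib Require List.
Require Import Defs.
From mathcomp Require Import all_boot.
From mathcomp Require Import boolp classical_sets cardinality filter.

Set Implicit Arguments.
Unset Strict Implicit.
Unset Printing Implicit Defensive.

Local Open Scope classical_set_scope.

(** * Diagrams and existential closures of finite tuples *)

Definition literal n (P : Prop) (p : form n) : form n :=
  if `[<P>] then p else FNot p.

Lemma fsat_literal (G : graph) n (P : Prop) (p : form n) (a : 'I_n -> G) :
  fsat (literal P p) a <-> (P <-> fsat p a).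
Proof. rewrite /literal; case: asboolP => HP /=; split; tauto. Qed.

Definition big_and n (t : form n) (I : finType) (p : I -> form n) : form n :=
  foldr (@FAnd n) t [seq p i | i : I].

Lemma fsat_big_and (G : graph) n (t : form n) (I : finType) (p : I -> form n)
    (a : 'I_n -> G) :
  fsat (big_and t p) a <-> fsat t a /\ forall i, fsat (p i) a.
Proof.
rewrite /big_and.
have -> : (forall i, fsat (p i) a) <-> (forall i, i \in enum I -> fsat (p i) a).
  by split=> h i; [move=> _|]; apply: h; rewrite ?mem_enum.
rewrite /image_mem; elim: (enum I) => [|i s IH] /=; first by split=> [|[]].
rewrite IH; split=> [[hi [ht hs]]|[ht hs]].
  split=> // j; rewrite in_cons => /orP[/eqP-> //|]; exact: hs.
split; first by apply: hs; rewrite mem_head.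
by split=> // j js; apply: hs; rewrite in_cons js orbT.
Qed.

Lemma quantifier_free_big_and n (t : form n) (I : finType) (p : I -> form n) :
  quantifier_free t -> (forall i, quantifier_free (p i)) ->
  quantifier_free (big_and t p).
Proof.
move=> ht hp; rewrite /big_and /image_mem.
by elim: (enum I) => //= i s ->; rewrite hp.
Qed.

Definition same_type (G H : graph) n (c : 'I_n -> G) (d : 'I_n -> H) : Prop :=
  forall i j, (c i = c j <-> d i = d j) /\ (adj (c i) (c j) <-> adj (d i) (d j)).

(* [form n] has no quantifier-free tautology when [n = 0], hence the quantified
   base case. *)
Definition diagram (G : graph) n (c : 'I_n -> G) : form n :=
  big_and (FAll (FEq ord0 ord0)) (fun ij : 'I_n * 'I_n =>
    FAnd (literal (c ij.1 = c ij.2) (FEq ij.1 ij.2))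
         (literal (adj (c ij.1) (c ij.2)) (FAdj ij.1 ij.2))).

Lemma fsat_diagram (G H : graph) n (c : 'I_n -> G) (d : 'I_n -> H) :
  fsat (diagram c) d <-> same_type c d.
Proof.
rewrite fsat_big_and /=; split=> [[_ h] i j|h].
  by have /= [/fsat_literal ? /fsat_literal] := h (i, j).
by split=> // -[i j] /=; have [? ?] := h i j; split; apply/fsat_literal.
Qed.

Lemma push0 (V : Type) n (x : V) (a : 'I_n -> V) : push x a ord0 = x.
Proof. by rewrite /push unlift_none. Qed.

Lemma push_lift (V : Type) n (x : V) (a : 'I_n -> V) i :
  push x a (lift ord0 i) = a i.
Proof. by rewrite /push liftK. Qed.

Lemma push_eta (V : Type) n (c : 'I_n.+1 -> V) :
  push (c ord0) (c \o lift ord0) = c.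
Proof.
by apply/funext => i; rewrite /push; case: unliftP => [j ->|->].
Qed.

Lemma comp_push (V W : Type) (f : V -> W) n (x : V) (a : 'I_n -> V) :
  f \o push x a = push (f x) (f \o a).
Proof. by apply/funext => i; rewrite /push /=; case: unlift. Qed.

Lemma rshiftS m n (i : 'I_n) :
  rshift m.+1 i = lift ord0 (rshift m i) :> 'I_(m.+1 + n).
Proof. exact: val_inj. Qed.

(** The quantified variables come first and the parameters last: each [FEx] binds variable [ord0],
    and [m'.+1 + n] is convertible to [(m' + n).+1], so no cast arises. *)
Fixpoint exists_n m n : form (m + n) -> form n :=
  match m with
  | 0 => fun p => p
  | m'.+1 => fun p => exists_n (FEx p)
  end.

Lemma fsat_exists_n (G : graph) m n (p : form (m + n)) (a : 'I_n -> G) :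
  fsat (exists_n p) a <->
  exists c : 'I_(m + n) -> G, (forall i, c (rshift m i) = a i) /\ fsat p c.
Proof.
elim: m p => [|m IH] p.
  have r0 (i : 'I_n) : rshift 0 i = i by exact: val_inj.
  split=> [pa|[c [ca pc]]]; first by exists a; split=> // i; rewrite r0.
  by suff <- : c = a by []; apply/funext => i; rewrite -ca r0.
rewrite /= IH; split=> [[c [ca [x px]]]|[c [ca pc]]].
  by exists (push x c); split=> // i; rewrite rshiftS push_lift.
exists (c \o lift ord0); split=> [i|]; first by rewrite /= -rshiftS.
by exists (c ord0); rewrite push_eta.
Qed.

(** * Embedding finite pieces over parameters *)

(** A finite piece of [H] is a tuple ending in [b], possibly with repetitions; [same_type] makes the
    assignment from [c] to [d] well defined and an embedding. *)
Definition finitely_embeds (H G : graph) n (b : 'I_n -> H) (a : 'I_n -> G) :=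
  forall m (c : 'I_(m + n) -> H), (forall i, c (rshift m i) = b i) ->
  exists d : 'I_(m + n) -> G,
    (forall i, d (rshift m i) = a i) /\ same_type c d.

Definition elem_equiv (G H : graph) n (a : 'I_n -> G) (b : 'I_n -> H) :=
  forall p : form n, fsat p a <-> fsat p b.

(** The existential closure of the diagram of [c] is a single formula, true of [b] and hence of
    [a]. *)
Lemma elem_equiv_finitely_embeds (G H : graph) n (a : 'I_n -> G)
    (b : 'I_n -> H) : elem_equiv a b -> finitely_embeds b a.
Proof.
move=> ab m c cb.
have /ab/fsat_exists_n[d [da /fsat_diagram cd]] :
    fsat (exists_n (diagram c)) b.
  by apply/fsat_exists_n; exists c; split=> //; apply/fsat_diagram.
by exists d.
Qed.

Lemma finitely_embeds_extension (H G G' : graph) n (b : 'I_n -> H)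
    (a : 'I_n -> G) (f : G -> G') :
  substructure f -> finitely_embeds b a -> finitely_embeds b (f \o a).
Proof.
move=> [f_inj f_adj] ba m c /ba[d [da cd]]; exists (f \o d); split=> [i|i j] /=.
  by rewrite da.
have [h1 h2] := cd i j; rewrite f_adj -h2 h1; split=> //.
by split=> [->|/f_inj].
Qed.

Lemma In_nth (T : Type) (x0 x : T) (s : seq T) :
  List.In x s -> exists2 j, j < size s & nth x0 s j = x.
Proof.
by elim: s => //= y s IH [->|/IH[j jm h]]; [exists 0|exists j.+1].
Qed.

(** The map [e] is total, so that for fixed [x] the values at [x], as [s] varies, represent an
    element of an ultrapower of [G]; it is an embedding only on [s]. *)
Definition partial_embedding (H G : graph) n (b : 'I_n -> H) (a : 'I_n -> G)
    (s : seq H) (e : H -> G) : Prop :=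
  (forall i, e (b i) = a i) /\
  forall x y, List.In x s -> List.In y s ->
    (e x = e y <-> x = y) /\ (adj (e x) (e y) <-> adj x y).

Lemma partial_embeddingP (H G : graph) n (b : 'I_n -> H) (a : 'I_n -> G) s :
  finitely_embeds b a -> exists e, partial_embedding b a s e.
Proof.
move=> ba; have [[x0 _]|H0] := pselect (exists x : H, True); last first.
  exists (fun x => False_rect _ (H0 (ex_intro _ x I))).
  by split=> [i|x]; case: (H0 (ex_intro _ _ I)).
(* The extra entry [x0] makes [m + n] a successor, so that [d ord0] below is available as a default
   value. *)
pose s' := x0 :: s; pose m := size s'.
pose c (k : 'I_(m + n)) := match fintype.split k with
  | inl j => nth x0 s' j | inr i => b i end.
have cb i : c (rshift m i) = b i.
  by rewrite /c -[rshift m i]/(unsplit (inr i)) unsplitK.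
have cs x : List.In x s -> exists k, c k = x.
  move=> xs; have [j jm <-] : exists2 j, j < m & nth x0 s' j = x.
    by apply: In_nth; right.
  exists (lshift n (Ordinal jm)).
  by rewrite /c -[lshift n _]/(unsplit (inl (Ordinal jm))) unsplitK.
have [d [da cd]] := ba m c cb.
pose e x := if pselect (exists k, c k = x) is left h then d (projT1 (cid h))
            else d ord0.
have ec k : e (c k) = d k.
  rewrite /e; case: pselect => [h|[]]; last by exists k.
  by case: (cid h) => j /= jk; apply/(cd j k).1.
exists e; split=> [i|x y /cs[i <-] /cs[j <-]]; first by rewrite -cb ec da.
by rewrite !ec; have [-> ->] := cd i j.
Qed.

(** * Ultrapowers and the theorem of Los *)

Lemma filterI_ex (T : Type) (F : set_system T) {FF : ProperFilter F}
    (A B : set T) : F A -> F B -> exists x, A x /\ B x.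
Proof. by move=> FA FB; have [x] := filter_ex (filterI FA FB); exists x. Qed.

Lemma choose_witness (I T : Type) (x0 : T) (P : I -> T -> Prop) :
  exists f : I -> T, forall i, (exists x, P i x) -> P i (f i).
Proof.
have h i : exists y, (exists x, P i x) -> P i y.
  by have [[x Px]|nP] := pselect (exists x, P i x); [exists x|exists x0].
by have [f fP] := choice h; exists f.
Qed.

Section Ultrapower.
Context (I : Type) (U : set_system I) (UU : UltraFilter U) (G : graph).
Implicit Types f g : I -> G.

Definition ueq f g : Prop := U [set i | f i = g i].

Lemma ueqxx f : ueq f f.
Proof. by apply: filterS filterT => i. Qed.

Lemma ueq_sym f g : ueq f g -> ueq g f.
Proof. by apply: filterS => i /= ->. Qed.

Lemma ueq_trans f g h : ueq f g -> ueq g h -> ueq f h.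
Proof. by apply: filterS2 => i /= -> ->. Qed.

(** The quotient by [ueq]: a vertex is an equivalence class, kept as a set of functions, so
    extensionality turns equivalence into equality. *)
Definition ultrapower_vertex : Type := {P : set (I -> G) | exists f, P = ueq f}.

Definition ueq_class f : ultrapower_vertex :=
  exist _ (ueq f) (ex_intro _ f erefl).

Lemma ueq_class_surj (P : ultrapower_vertex) : exists f, P = ueq_class f.
Proof. by case: P => P [f Pf]; exists f; apply: eq_exist. Qed.

Lemma ueq_classP f g : ueq_class f = ueq_class g <-> ueq f g.
Proof.
split=> [[fg]|fg]; first by rewrite fg; exact: ueqxx.
apply: eq_exist; apply/funext => h; apply/propext; split; apply: ueq_trans => //.
exact: ueq_sym.
Qed.

Definition ultrapower_adj (P Q : ultrapower_vertex) : Prop :=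
  exists f g, [/\ P = ueq_class f, Q = ueq_class g & U [set i | adj (f i) (g i)]].

Lemma ultrapower_adjE f g :
  ultrapower_adj (ueq_class f) (ueq_class g) <-> U [set i | adj (f i) (g i)].
Proof.
split=> [[f' [g' [/ueq_classP ff' /ueq_classP gg' h]]]|h]; last by exists f, g.
by apply: filterS3 ff' gg' h => i /= -> ->.
Qed.

Lemma ultrapower_adj_irrefl P : ~ ultrapower_adj P P.
Proof.
have [f ->] := ueq_class_surj P; rewrite ultrapower_adjE => /filter_ex[i /=].
exact: adj_irrefl.
Qed.

Lemma ultrapower_adj_sym P Q : ultrapower_adj P Q -> ultrapower_adj Q P.
Proof.
move=> [f [g [-> -> h]]]; apply/ultrapower_adjE; apply: filterS h => i.
exact: adj_sym.
Qed.

Definition ultrapower : graph :=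
  Graph ultrapower_adj_irrefl ultrapower_adj_sym.

Definition uclass (f : I -> G) : ultrapower := ueq_class f.

Lemma ultraN (A : set I) : U (~` A) <-> ~ U A.
Proof.
split=> [UnA UA|]; last by case: (in_ultra_setVsetC A UU).
by have [i []] := filterI_ex UA UnA.
Qed.

(** Negation, disjunction and implication rest on [ultraN]; the quantifiers rest on choosing a
    witness or counterexample in each coordinate. *)
Lemma los_theorem n (p : form n) (a : 'I_n -> I -> G) :
  fsat p (uclass \o a) <-> U [set i | fsat p (a^~ i)].
Proof.
elim: {n}p a => [n i j|n i j|n p IH|n p IHp q IHq|n p IHp q IHq|n p IHp q IHq
                |n p IH|n p IH] a /=.
- exact: ueq_classP.
- exact: ultrapower_adjE.
- by rewrite IH -ultraN.
- rewrite IHp IHq; split=> [[Up Uq]|Upq]; first exact: filterI.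
  by split; apply: filterS Upq => i [].
- rewrite IHp IHq; split=> [[|]|Upq].
  + by apply: filterS => i; left.
  + by apply: filterS => i; right.
  apply: contrapT => /not_orP[/ultraN Up /ultraN Uq].
  by have [i [[? ?] []]] := filterI_ex (filterI Up Uq) Upq.
- rewrite IHp IHq; split=> [Upq|Upq Up]; last first.
    by apply: filterS2 Upq Up => i; apply.
  have [/Upq|/ultraN] := pselect (U [set i | fsat p (a^~ i)]).
    by apply: filterS => i /= qi _.
  by apply: filterS => i /= np /np.
- have pushE i f : (push f a)^~ i = push (f i) (a^~ i).
    exact: (comp_push (fun h : I -> G => h i)).
  split=> [h|h P].
    apply: contrapT => /ultraN Un.
    (* [G] may be empty; some coordinate has a counterexample [x0], which serves as default in the
       coordinates that have none. *)
    have [i0 /existsNP[x0 _]] := filter_ex Un.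
    have [f fP] := choose_witness x0 (fun i x => ~ fsat p (push x (a^~ i))).
    have := h (uclass f); rewrite -comp_push IH => Up.
    have [i [/= + /existsNP/fP]] := filterI_ex Up Un.
    by rewrite pushE.
  have [f ->] := ueq_class_surj P; rewrite -[ueq_class f]/(uclass f) -comp_push IH.
  by apply: filterS h => i /=; rewrite pushE.
- have pushE i f : (push f a)^~ i = push (f i) (a^~ i).
    exact: (comp_push (fun h : I -> G => h i)).
  split=> [[P]|h].
    have [f ->] := ueq_class_surj P; rewrite -[ueq_class f]/(uclass f) -comp_push IH.
    by apply: filterS => i /=; rewrite pushE; exists (f i).
  have [i0 [x0 _]] := filter_ex h.
  have [f fP] := choose_witness x0 (fun i x => fsat p (push x (a^~ i))).
  exists (uclass f); rewrite -comp_push IH.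
  by apply: filterS h => i /= /fP; rewrite pushE.
Qed.

Lemma ultrapower_elem_equiv n (a : 'I_n -> G) :
  elem_equiv a (fun j => uclass (fun=> a j)).
Proof.
move=> p; rewrite (los_theorem p (fun j _ => a j)) /=; split=> [pa|/filter_ex[]//].
by apply: filterS filterT.
Qed.

End Ultrapower.

(** * From finite embeddings to an ultrapower *)

(** The index set consists of the finite lists of vertices of [H], and [x] goes to the class of its
    images under the partial embeddings. The ultrafilter contains, for each list [t], the set of
    lists extending [t]; so whatever concerns two vertices is decided at almost every index. *)
Lemma finitely_embeds_ultrapower (H G : graph) n (b : 'I_n -> H)
    (a : 'I_n -> G) :
  finitely_embeds b a ->
  exists (K : graph) (g : H -> K), substructure g /\ elem_equiv a (g \o b).
Proof.
move=> ba.
have [e eP] := choice (fun s => partial_embeddingP s ba).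
pose B (t : seq H) : set (seq H) := [set s | forall x, List.In x t -> List.In x s].
have FB : ProperFilter (filter_from setT B).
  apply: filter_from_proper => [|t _]; last by exists t.
  apply: filter_fromT_filter => [|s t]; first by exists [::].
  by exists (s ++ t) => r h; split=> x xs; apply: h; apply/List.in_app_iff; tauto.
have [U [UU BU]] := ultraFilterLemma FB.
have UB t : U (B t) by apply: BU; exists t.
pose g x := uclass UU (fun s => e s x).
exists (ultrapower UU G), g; split; last first.
  move=> p; rewrite (ultrapower_elem_equiv UU).
  (* Each [e s] sends [b j] to [a j], so the parameters become constant sequences. *)
  suff -> : g \o b = (fun j => uclass UU (fun=> a j)) by [].
  apply/funext => j; rewrite /g /uclass /=; congr ueq_class; apply/funext => s.
  exact: (eP s).1.
have eB x y s : B [:: x; y] s ->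
    (e s x = e s y <-> x = y) /\ (adj (e s x) (e s y) <-> adj x y).
  by move=> Bs; apply: (eP s).2; apply: Bs => /=; tauto.
split=> [x y /ueq_classP exy|x y].
  by have [s [/= + /eB[<-]]] := filterI_ex exy (UB [:: x; y]).
rewrite [adj (g x) (g y)]ultrapower_adjE; split=> [exy|xy].
  by have [s [/= + /eB[_ <-]]] := filterI_ex exy (UB [:: x; y]).
by apply: filterS (UB [:: x; y]) => s /eB[_ /= ->].
Qed.

(** * Invariance of modal truth under elementary equivalence *)

Lemma elem_equiv_sym (G H : graph) n (a : 'I_n -> G) (b : 'I_n -> H) :
  elem_equiv a b -> elem_equiv b a.
Proof. by move=> ab p; rewrite ab. Qed.

Lemma elem_equiv_extension (G H G' : graph) n (a : 'I_n -> G) (b : 'I_n -> H)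
    (f : G -> G') :
  elem_equiv a b -> substructure f ->
  exists (H' : graph) (g : H -> H'),
    substructure g /\ elem_equiv (f \o a) (g \o b).
Proof.
move=> /elem_equiv_finitely_embeds ba sf.
exact: finitely_embeds_ultrapower (finitely_embeds_extension sf ba).
Qed.

(** By [elem_equiv_extension], elementary equivalence is a bisimulation for the extension relation:
    an extension on either side is matched by one on the other. Both modal cases follow. *)
Lemma msat_elem_equiv n (phi : mform n) (G H : graph) (a : 'I_n -> G)
    (b : 'I_n -> H) :
  elem_equiv a b -> (msat phi a <-> msat phi b).
Proof.
elim: phi G H a b => [p|p IH|p IHp q IHq|p IHp q IHq|p IHp q IHq|p IH|p IH]
  G H a b ab /=.
- exact: ab.
- by rewrite (IH _ _ _ _ ab).
- by rewrite (IHp _ _ _ _ ab) (IHq _ _ _ _ ab).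
- by rewrite (IHp _ _ _ _ ab) (IHq _ _ _ _ ab).
- by rewrite (IHp _ _ _ _ ab) (IHq _ _ _ _ ab).
- split=> -[K [f [sf pf]]].
    have [K' [g [sg e]]] := elem_equiv_extension ab sf.
    by exists K', g; split=> //; apply/(IH _ _ _ _ e).
  have [K' [g [sg e]]] := elem_equiv_extension (elem_equiv_sym ab) sf.
  by exists K', g; split=> //; apply/(IH _ _ _ _ e).
- split=> h K f sf.
    have [K' [g [sg e]]] := elem_equiv_extension (elem_equiv_sym ab) sf.
    by apply/(IH _ _ _ _ e); apply: h.
  have [K' [g [sg e]]] := elem_equiv_extension ab sf.
  by apply/(IH _ _ _ _ e); apply: h.
Qed.

(** * Finite embeddings from the finite pattern property *)

(* The definition allows [v \in B]. To avoid this, let [w] be adjacent to all of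
   [A] and [B] and ask that [v] be not adjacent to [w]. *)
Lemma finite_pattern_property_new (G : graph) (A B : set G) :
  finite_pattern_property G -> finite_set A -> finite_set B -> A `&` B = set0 ->
  exists v : G, [/\ ~ A v, ~ B v, forall x, A x -> adj v x
                  & forall x, B x -> ~ adj v x].
Proof.
move=> fpp finA finB AB0.
have [w [wAB _]] : exists w : G, (forall x, (A `|` B) x -> adj w x) /\
    (forall x, set0 x -> ~ adj w x).
  by apply: fpp; rewrite ?finite_setU ?setI0.
have [v [vA vB]] : exists v : G, (forall x, A x -> adj v x) /\
    (forall x, (B `|` [set w]) x -> ~ adj v x).
  apply: fpp => //; first by rewrite finite_setU.
  rewrite setIUr AB0 set0U -subset0 => x [Ax /= xw].
  by apply: (@adj_irrefl _ w); apply: wAB; left; rewrite -xw.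
exists v; split=> // [/vA|Bv|x Bx]; first exact: adj_irrefl.
- by apply: (vB w); [right|apply: adj_sym; apply: wAB; right].
- by apply: vB; left.
Qed.

(** The tuple is copied into [G] one vertex at a time, each new vertex realizing the required
    adjacencies to those already placed. *)
Lemma finite_pattern_property_finitely_embeds (G H : graph) (f : G -> H) n
    (a : 'I_n -> G) :
  finite_pattern_property G -> substructure f -> finitely_embeds (f \o a) a.
Proof.
move=> fpp [f_inj f_adj]; elim=> [|m IH] c ca.
  have r0 (i : 'I_n) : rshift 0 i = i by exact: val_inj.
  have -> : c = f \o a by apply/funext => i; rewrite -ca r0.
  exists a; split=> [i|i j]; first by rewrite r0.
  by split; [split=> [/f_inj|/= ->]|exact: f_adj].
have [d [da cd]] : exists d : 'I_(m + n) -> G,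
    (forall i, d (rshift m i) = a i) /\ same_type (c \o lift ord0) d.
  by apply: IH => i; rewrite /= -rshiftS.
have ext v : (forall i, (c ord0 = c (lift ord0 i) <-> v = d i) /\
    (adj (c ord0) (c (lift ord0 i)) <-> adj v (d i))) ->
    exists d : 'I_(m.+1 + n) -> G,
      (forall i, d (rshift m.+1 i) = a i) /\ same_type c d.
  move=> vP; exists (push v d); split=> [i|i j].
    by rewrite rshiftS push_lift.
  have adjC (K : graph) (x y : K) : adj x y <-> adj y x by split; exact: adj_sym.
  have eqC (T : Type) (x y : T) : x = y <-> y = x by split.
  case: (unliftP ord0 i) => [i' ->|->]; case: (unliftP ord0 j) => [j' ->|->];
    rewrite ?push_lift ?push0.
  - exact: cd.
  - by rewrite adjC [adj (d _) _]adjC eqC [d _ = _]eqC; exact: vP.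
  - exact: vP.
  - by split=> //; split=> /adj_irrefl.
(* A repeated vertex must receive its earlier image; only a new one calls for the pattern
   property. *)
have [[i0 ci0]|cN] := pselect (exists i, c (lift ord0 i) = c ord0).
  apply: (ext (d i0)) => i; rewrite -ci0; exact: (cd i0 i).
have finI (P : set 'I_(m + n)) : finite_set (d @` P).
  by apply: finite_image; exact: finite_finset.
have [] := @finite_pattern_property_new G
  (d @` [set i | adj (c ord0) (c (lift ord0 i))])
  (d @` [set i | ~ adj (c ord0) (c (lift ord0 i))]) fpp (finI _) (finI _).
  rewrite -subset0 => x [[i /= hi <-] [j /= hj /(cd j i).1 /= e]].
  by apply: hj; rewrite e.
move=> v [vA vB adjA adjB]; apply: (ext v) => i; split.
  split=> [e|e]; first by case: cN; exists i.
  (* Every [d i] lies in one of the two sets, and [v] avoids both, so [v] differs from every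
     [d i]. *)
  by have [h|h] := pselect (adj (c ord0) (c (lift ord0 i)));
    [case: vA|case: vB]; exists i.
split=> h; first by apply: adjA; exists i.
by apply: contrapT => nh; apply: adjB h; exists i.
Qed.

(** * Adding a vertex and necessity of patterns *)

Section AddVertex.
Context (G : graph) (A : set G).

Definition add_vertex_adj (x y : option G) : Prop :=
  match x, y with
  | Some x, Some y => adj x y
  | Some x, None | None, Some x => A x
  | None, None => False
  end.

Lemma add_vertex_adj_irrefl x : ~ add_vertex_adj x x.
Proof. by case: x => [x|] //=; exact: adj_irrefl. Qed.

Lemma add_vertex_adj_sym x y : add_vertex_adj x y -> add_vertex_adj y x.
Proof. by case: x y => [x|] [y|] //=; exact: adj_sym. Qed.

Definition add_vertex : graph := Graph add_vertex_adj_irrefl add_vertex_adj_sym.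

Lemma add_vertex_substructure : substructure (Some : G -> add_vertex).
Proof. by split=> [x y []|]. Qed.

End AddVertex.

(** The bound variable supplies a quantifier-free tautology as base case even for [n = 0], so that
    [FEx] of this formula is existential. *)
Definition pattern n (P : set 'I_n) : form n.+1 :=
  big_and (FEq ord0 ord0)
    (fun i : 'I_n => literal (P i) (FAdj ord0 (lift ord0 i))).

Lemma quantifier_free_pattern n (P : set 'I_n) : quantifier_free (pattern P).
Proof. by apply: quantifier_free_big_and => // i; rewrite /literal; case: asbool. Qed.

Lemma fsat_pattern (G : graph) n (P : set 'I_n) (x : G) (a : 'I_n -> G) :
  fsat (pattern P) (push x a) <-> forall i, P i <-> adj x (a i).
Proof.
rewrite fsat_big_and /=; split=> [[_ h] i|h].
  by have /fsat_literal := h i; rewrite /= push0 push_lift.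
by split=> // i; apply/fsat_literal; rewrite /= push0 push_lift.
Qed.

Lemma finite_set_range (T : Type) (A : set T) :
  finite_set A -> exists n (a : 'I_n -> T), A = range a.
Proof.
move=> /(@finite_seqP {classic T})[s ->]; exists (size s), (tnth (in_tuple s)).
apply/seteqP; split=> x /=; rewrite -[x \in s]/(x \in in_tuple s).
  by move=> /tnthP[i ->]; exists i.
by move=> [i _ <-]; exact: mem_tnth.
Qed.

Lemma existential_maximality_finite_pattern (G : graph) :
  (forall n (phi0 : form n.+1) (a : 'I_n -> G),
     quantifier_free phi0 -> msat (maximality (MForm (FEx phi0))) a) ->
  finite_pattern_property G.
Proof.
move=> maxG A B finA finB AB0.
have [n [a aAB]] : exists n (a : 'I_n -> G), A `|` B = range a.
  by apply: finite_set_range; rewrite finite_setU.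
have [||v /fsat_pattern vP] := maxG n (pattern (A \o a)) a.
- exact: quantifier_free_pattern.
(* The new vertex [None] has neighbourhood [A]. Its image in any further extension keeps the same
   adjacencies to the parameters, so the pattern is necessary. *)
- exists (add_vertex A), Some; split; first exact: add_vertex_substructure.
  move=> K g [_ g_adj]; exists (g None); apply/fsat_pattern => i.
  by rewrite /= g_adj.
- have ABa x : (A `|` B) x -> exists i, a i = x.
    by rewrite aAB => -[i _ <-]; exists i.
  exists v; split=> [x Ax|x Bx].
    by have [i ix] := ABa x (or_introl Ax); rewrite -ix; apply/vP; rewrite /= ix.
  have [i ix] := ABa x (or_intror Bx); rewrite -ix => /vP /=; rewrite ix => Ax.
  by have : (A `&` B) x by []; rewrite AB0.
Qed.

(** * Maximality for modal assertions and the equivalence *)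

Lemma finite_pattern_maximality (G : graph) n (phi : mform n) (a : 'I_n -> G) :
  finite_pattern_property G -> msat (maximality phi) a.
Proof.
move=> fpp [H [f [sf Hphi]]].
have fa := @finite_pattern_property_finitely_embeds _ _ _ _ a fpp sf.
have [K [g [sg e]]] := finitely_embeds_ultrapower fa.
(* [K] extends [H], where [phi] is necessary, so [phi] holds at [K]; elementary equivalence brings
   it back to [G]. *)
by apply/(msat_elem_equiv phi e); exact: Hphi.
Qed.

Theorem theorem39 (G : graph) :
  [<-> forall (n : nat) (phi : mform n) (a : 'I_n -> G),
         msat (maximality phi) a;
       forall (n : nat) (phi : form n) (a : 'I_n -> G),
         msat (maximality (MForm phi)) a;
       forall (n : nat) (phi0 : form n.+1) (a : 'I_n -> G),
         quantifier_free phi0 -> msat (maximality (MForm (FEx phi0))) a;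
       finite_pattern_property G].
Proof.
tfae=> [h n phi a|h n phi0 a _||fpp n phi a].
- exact: h.
- exact: h.
- exact: existential_maximality_finite_pattern.
- exact: finite_pattern_maximality.
Qed.
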